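(* Assume: (i) $n,d\to\infty$ with $n/d\to r\in(0,\infty)$; (ii) the data distribution $\pi_0$ on $\mathbb{R}^d$ has mean $0$ and covariance $\Sigma$ with $\liminf_{d\to\infty}\mathrm{Tr}(\Sigma)/d\ge c_0>0$, and satisfies a log-Sobolev inequality with a constant $C_{\mathrm{LSI}}\ge 1$ independent of $d$. Let $v\in\mathbb R^d$ with $\|v\|_2=1$. Then there exists a constant $c>0$ such that $$\|\widehat f^\star_v-\mathsf z_v\|_{L^2(\widehat\pi_{d,n})}\le e^{-d^c}$$ with very high probability, where $\mathsf z_v(x,z)=-\langle v,z\rangle$ and $\widehat f^\star_v$ is the $v$-coordinate of the empirical Bayes denoiser.
   Context: All objects are indexed by $d$, with $n=n_d$, $\pi_0=\pi_{0,d}$; the diffusion time $t>0$ is fixed independently of $d$, $\rho=e^{-t}$, $\sigma=\sqrt{1-e^{-2t}}$. Training data $x_{0,1},\dots,x_{0,n}$ are i.i.d. from $\pi_0$. The log-Sobolev inequality with constant $C_{\mathrm{LSI}}$ is $\mathbb E_{\pi_0}[f^2\log f^2]-\mathbb E_{\pi_0}[f^2]\log\mathbb E_{\pi_0}[f^2]\le 2C_{\mathrm{LSI}}\mathbb E_{\pi_0}\|\nabla f\|_2^2$ for all $f\in W^{1,2}(\pi_0)$. $\widehat\pi_{d,n}=\mathrm{Unif}(\{x_{0,i}\}_{i\le n})\otimes\mathcal N(0,I_d)$. The empirical Bayes denoiser is $\widehat{\mathbf f}^\star(u)=\frac1\sigma\sum_{k=1}^n\omega_k(u)(\rho x_{0,k}-u)$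 with $\omega_k(u)=e^{-\|\rho x_{0,k}-u\|^2/(2\sigma^2)}/\sum_je^{-\|\rho x_{0,j}-u\|^2/(2\sigma^2)}$; $\widehat f^\star_v=\langle v,\widehat{\mathbf f}^\star\rangle$ is identified with the function $(x,z)\mapsto\widehat f^\star_v(\rho x+\sigma z)$ in $L^2(\widehat\pi_{d,n})$. An event $\mathcal E$ holds with very high probability if $\mathbb P(\mathcal E^c)\le e^{-d^{c'}}$ for some constant $c'>0$ and all large $d$. *)

(* Defs.v *)
From HB Require Import structures.
From mathcomp Require Import all_boot all_order all_algebra.
From mathcomp Require Import interval_inference.
From mathcomp Require Import all_classical all_reals all_analysis.

Set Implicit Arguments.
Unset Strict Implicit.
Unset Printing Implicit Defensive.
Import Order.TTheory GRing.Theory Num.Theory.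
Import numFieldNormedType.Exports.

Local Open Scope classical_set_scope.
Local Open Scope ring_scope.

Section Euclidean.
Context {R : realType} {d : nat}.
Implicit Types u v : 'rV[R]_d.

(* The library norm `|u| on 'rV[R]_d is the sup norm, hence enorm. *)
Definition dotp u v : R := \sum_i u 0 i * v 0 i.

Definition enorm u : R := Num.sqrt (dotp u u).

End Euclidean.

(* R^d carries the sigma-algebra generated by the coordinates, i.e. the Borel
   sigma-algebra; this is the row-vector analogue of the library instance on
   d.-tuple. *)
Section rV_measurable.
Context {R : realType} (d : nat).

Let coors (i : 'I_d) (x : 'rV[R]_d) : measurableTypeR R := x 0 i.

Let rV_set0 : g_sigma_preimage coors set0.
Proof. exact: sigma_algebra0. Qed.

Let rV_setC A : g_sigma_preimage coors A -> g_sigma_preimage coors (~` A).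
Proof. exact: sigma_algebraC. Qed.

Let rV_bigcup (F : (set 'rV[R]_d)^nat) :
  (forall i, g_sigma_preimage coors (F i)) ->
  g_sigma_preimage coors (\bigcup_i (F i)).
Proof. exact: sigma_algebra_bigcup. Qed.

HB.instance Definition _ := @isMeasurable.Build default_measure_display
  'rV[R]_d (g_sigma_preimage coors) rV_set0 rV_setC rV_bigcup.

Lemma measurable_coord (i : 'I_d) :
  measurable_fun [set: 'rV[R]_d] (fun x : 'rV[R]_d => x 0 i).
Proof.
move=> _ Y mY; rewrite setTI; apply: sub_sigma_algebra => /=.
rewrite -bigcup_seq/=; exists i => /=; first by rewrite mem_index_enum.
by exists Y => //; rewrite setTI.
Qed.

Lemma measurable_fun_rVP (dT : measure_display) (T : measurableType dT)
    (f : T -> 'rV[R]_d) :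
  (forall i, measurable_fun [set: T] (fun t => f t 0 i)) ->
  measurable_fun [set: T] f.
Proof.
move=> mf _ A mA; rewrite setTI.
suff /(_ A mA) : measurable `<=` [set B : set 'rV[R]_d | measurable (f @^-1` B)].
  by [].
apply: smallest_sub.
  split => /=.
  - by rewrite preimage_set0.
  - by move=> B mB; rewrite setTD preimage_setC; exact: measurableC.
  - by move=> F mF; rewrite preimage_bigcup; exact: bigcup_measurable.
rewrite -bigcup_seq => B [i _] [C mC <-] /=.
have := mf i measurableT _ mC; rewrite setTI.
by rewrite setTI.
Qed.

End rV_measurable.

(* N(0, I_d), by recursion on d as the law of (z_0, z') with z_0 standard normal
   and z' an independent N(0, I_(d-1)). *)
Section std_gaussian.
Context {R : realType}.

Definition rV_cons (d : nat) (p : measurableTypeR R * 'rV[R]_d) : 'rV[R]_d.+1 :=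
  row_mx (const_mx p.1 : 'rV_1) p.2.

Lemma rV_cons0 (d : nat) (p : R * 'rV[R]_d) : rV_cons p 0 ord0 = p.1.
Proof.
rewrite (_ : ord0 = lshift d (ord0 : 'I_1)); last exact: val_inj.
apply: eq_trans (row_mxEl (const_mx p.1 : 'rV_1) p.2 0 ord0) _.
by rewrite mxE.
Qed.

Lemma rV_consS (d : nat) (p : R * 'rV[R]_d) (i : 'I_d) :
  rV_cons p 0 (lift ord0 i) = p.2 0 i.
Proof.
rewrite (_ : lift ord0 i = rshift 1 i); last exact: val_inj.
exact: (row_mxEr (const_mx p.1 : 'rV_1) p.2 0 i).
Qed.

Lemma measurable_rV_cons (d : nat) : measurable_fun setT (@rV_cons d).
Proof.
apply: measurable_fun_rVP => i; have [j ->|->] := unliftP ord0 i.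
- rewrite (_ : (fun _ => _) = (fun x : 'rV[R]_d => x 0 j) \o snd).
    by apply: measurableT_comp => //; exact: measurable_coord.
  by apply/funext => p; rewrite rV_consS.
- by rewrite (_ : (fun _ => _) = fst)//; apply/funext => p; rewrite rV_cons0.
Qed.

HB.instance Definition _ (d : nat) :=
  isMeasurableFun.Build _ _ _ _ (@rV_cons d) (@measurable_rV_cons d).

Fixpoint std_gaussian (d : nat) : probability 'rV[R]_d R :=
  match d with
  | 0 => \d_(0 : 'rV[R]_0)
  | d'.+1 => distribution (normal_prob 0 1 \x std_gaussian d')%E (@rV_cons d')
  end.

Lemma measurable_rV_box (d : nat) (A : 'I_d -> set R) :
  (forall i, measurable (A i)) ->
  measurable [set z : 'rV[R]_d | forall i, A i (z 0 i)].
Proof.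
move=> mA.
rewrite (_ : [set z : 'rV[R]_d | _] =
  \bigcap_(i in [set: 'I_d]) ((fun z : 'rV[R]_d => z 0 i) @^-1` A i)); last first.
  by apply/seteqP; split => z /= h i; [move=> _; exact: h|exact: h].
apply: fin_bigcap_measurable => // i _.
by have := measurable_coord i measurableT (mA i); rewrite setTI.
Qed.

Lemma std_gaussian_box (d : nat) (A : 'I_d -> set R) :
  (forall i, measurable (A i)) ->
  std_gaussian d [set z : 'rV[R]_d | forall i, A i (z 0 i)] =
    (\big[*%E/1]_(i < d) normal_prob 0 1 (A i))%E.
Proof.
elim: d A => [|d IH] A mA.
  rewrite big_ord0 /= (_ : [set _ | _] = setT) ?diracT//.
  by apply/seteqP; split => // z _ [].
rewrite big_ord_recl -IH; last by move=> i; exact: mA.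
have mB := @measurable_rV_box d (fun i => A (lift ord0 i)) (fun i => mA _).
have <- := @product_measure1E _ _ _ _ R (normal_prob 0 1) (std_gaussian d)
  (A ord0) _ (mA ord0) mB.
rewrite /= /distribution /pushforward; congr (_ _).
apply/seteqP; split => p /=.
- move=> h; split => [|i]; first by have := h ord0; rewrite rV_cons0.
  by have := h (lift ord0 i); rewrite rV_consS.
- move=> -[h0 h] i; by have [j ->|->] := unliftP ord0 i; rewrite ?rV_consS ?rV_cons0.
Qed.

End std_gaussian.

Section log_sobolev.
Context {R : realType} {d : nat}.
Implicit Types (pi : probability 'rV[R]_d R) (f : 'rV[R]_d -> R)
  (g : 'rV[R]_d -> 'rV[R]_d).

Definition gradient f (x : 'rV[R]_d) : 'rV[R]_d :=
  \row_i 'D_(delta_mx 0 i) f x.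

Definition C1 f := (forall x, differentiable f x) /\ continuous (gradient f).

Definition L2 pi f := f \in Lfun pi 2%:E.

Definition L2_vec pi g := forall i, L2 pi (fun x => g x 0 i).

Definition L2_cvg pi (u : nat -> 'rV[R]_d -> R) f :=
  Lnorm pi 2%:E (fun x => (u k x - f x)%:E) @[k --> \oo] --> 0%E.

(* W12 pi f g: f belongs to W^{1,2}(pi) with (weak) gradient g, where W^{1,2}(pi)
   is the closure of {phi in C^1 | phi and grad phi in L^2(pi)} for the norm
   (|phi|_{L^2(pi)}^2 + |grad phi|_{L^2(pi)}^2)^(1/2). By cut-off and
   mollification, C_c^oo has the same closure. The gradient is part of the data
   because, for an arbitrary law pi, it need not be determined by f. *)
Definition W12 pi f g :=
  [/\ L2 pi f, L2_vec pi g &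
    exists phi : nat -> 'rV[R]_d -> R,
      [/\ forall k, [/\ C1 (phi k), L2 pi (phi k) & L2_vec pi (gradient (phi k))],
          L2_cvg pi phi f &
          forall i, L2_cvg pi (fun k x => gradient (phi k) x 0 i)
                              (fun x => g x 0 i)]].

(* The convention 0 * log 0 = 0 holds because ln 0 = 0 in the library. The first
   expectation is taken in \bar R and may be +oo; its negative part is finite
   since s * ln s >= - 1/e. *)
Definition entropy_sq pi f : \bar R :=
  let m := fine 'E_pi[fun x => (f x ^+ 2)%R]%E in
  ('E_pi[fun x => (f x ^+ 2 * ln (f x ^+ 2))%R] - (m * ln m)%R%:E)%E.

Definition log_sobolev pi (C : R) :=
  forall f g, W12 pi f g ->
    (entropy_sq pi f <= (2 * C)%R%:E * 'E_pi[fun x => (enorm (g x) ^+ 2)%R])%E.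

End log_sobolev.

Section moments.
Context {R : realType} {d : nat}.
Implicit Types pi : probability 'rV[R]_d R.

Definition coord (i : 'I_d) (x : 'rV[R]_d) : R := x 0 i.

Definition has_mean_cov pi (mu : 'rV[R]_d) (Sigma : 'M[R]_d) :=
  [/\ forall i, coord i \in Lfun pi 2%:E,
      forall i, 'E_pi[coord i]%E = (mu 0 i)%:E &
      forall i j, covariance pi (coord i) (coord j) = (Sigma i j)%:E].

End moments.

Section sampling.
Context {R : realType} {dO dT : measure_display} {Omega : measurableType dO}
  {T : measurableType dT}.
Local Open Scope ereal_scope.

Definition iid (P : probability Omega R) (pi : probability T R) (n : nat)
    (X : 'I_n -> {RV P >-> T}) :=
  (forall i A, measurable A -> distribution P (X i) A = pi A) /\
  (forall (J : {set 'I_n}) (A : 'I_n -> set T),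
    (forall i, measurable (A i)) ->
    P (\bigcap_(i in [set` J]) (X i @^-1` A i)) =
      \big[*%E/1]_(i in J) P (X i @^-1` A i)).

End sampling.

(* A sequence of events E_d, each in its own probability space. *)
Definition very_high_probability {R : realType} {disp : nat -> measure_display}
    {Omega : forall d, measurableType (disp d)}
    (P : forall d, probability (Omega d) R) (E : forall d, set (Omega d)) :=
  exists2 c' : R, 0 < c' &
    \forall d \near \oo, (P d (~` E d) <= (expR (- (d%:R `^ c')))%:E)%E.

Section denoiser.
Context {R : realType} {d n : nat}.
Variables (t : R) (x : 'I_n -> 'rV[R]_d).
Implicit Types (u v : 'rV[R]_d) (p : 'rV[R]_d * 'rV[R]_d).

Definition rho : R := expR (- t).

Definition sigma : R := Num.sqrt (1 - expR (- (2 * t))).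

Definition unnormalized_weight k u : R :=
  expR (- (enorm (rho *: x k - u) ^+ 2 / (2 * sigma ^+ 2))).

Definition weight k u : R :=
  unnormalized_weight k u / \sum_j unnormalized_weight j u.

Definition denoiser u : 'rV[R]_d :=
  sigma^-1 *: \sum_k weight k u *: (rho *: x k - u).

Definition denoiser_coord v p : R :=
  dotp v (denoiser (rho *: p.1 + sigma *: p.2)).

Definition noise_coord v p : R := - dotp v p.2.

(* codom x lists x_0, ..., x_(n-1): points occurring several times are counted
   with multiplicity. *)
Definition empirical : {measure set 'rV[R]_d -> \bar R} :=
  mscale (n%:R^-1)%:nng
    (msum (fun k => \d_((codom x)`_k)) n).

Definition empirical_noise : {measure set ('rV[R]_d * 'rV[R]_d) -> \bar R} :=
  (empirical \x std_gaussian d)%E.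

End denoiser.

(* Main.v *)
(* At [u = rho x_k + sigma z] the denoising error is
   [(rho / sigma) sum_j w_j <v, x_j - x_k>], and
   [w_j <= sqrt (W_j / W_k) = exp (- rho^2 |x_j - x_k|^2 / (4 sigma^2)
   + rho <x_j - x_k, z> / (2 sigma))]. By Jensen's inequality and the Gaussian
   moment generating function, the squared error integrated over z is at most
   [16 sum_(j != k) exp (- l |x_j - x_k|^2)] with
   [l = rho^2 / (16 sigma^2)].

   The log-Sobolev inequality for [exp (- l |x - y|^2 / 2)] bounds the Laplace
   transform of the squared distance to any fixed y. With
   [F l = E (exp (- l |x - y|^2))] it reads
   [- F ln F <= - (l + 2 C l^2) F'], so that [- ln F l * (1 / l + 2 C)] is
   nondecreasing; its limit at 0 is [E |x - y|^2 >= tr Sigma], whence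
   [F l <= exp (- l tr Sigma / (1 + 2 C l))]. By independence of the samples the
   expected squared L2 error is therefore at most [16 n exp (- kappa d)], and
   Markov's inequality concludes. *)

Require Import Defs.
From HB Require Import structures.
From mathcomp Require Import all_boot all_order all_algebra.
From mathcomp Require Import all_classical all_reals all_analysis.
From mathcomp Require Import measurable_realfun ring lra.

Set Implicit Arguments.
Unset Strict Implicit.
Unset Printing Implicit Defensive.
Import Order.TTheory GRing.Theory Num.Theory.
Import numFieldNormedType.Exports.

Local Open Scope classical_set_scope.
Local Open Scope ring_scope.

(** * Euclidean and Gaussian preliminaries *)

Section euclidean.
Context {R : realType} {d : nat}.
Implicit Types u v w : 'rV[R]_d.

Lemma dotpC u v : dotp u v = dotp v u.
Proof. by apply: eq_bigr => i _; rewrite mulrC. Qed.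

Lemma dotpDl u v w : dotp (u + v) w = dotp u w + dotp v w.
Proof. by rewrite -big_split; apply: eq_bigr => i _; rewrite mxE mulrDl. Qed.

Lemma dotpZl a u v : dotp (a *: u) v = a * dotp u v.
Proof. by rewrite big_distrr; apply: eq_bigr => i _; rewrite mxE -mulrA. Qed.

Lemma dotpNl u v : dotp (- u) v = - dotp u v.
Proof. by rewrite -scaleN1r dotpZl mulN1r. Qed.

Lemma dotpDr u v w : dotp u (v + w) = dotp u v + dotp u w.
Proof. by rewrite dotpC dotpDl 2!(dotpC u). Qed.

Lemma dotpZr a u v : dotp u (a *: v) = a * dotp u v.
Proof. by rewrite dotpC dotpZl (dotpC v). Qed.

Lemma dotpNr u v : dotp u (- v) = - dotp u v.
Proof. by rewrite dotpC dotpNl (dotpC v). Qed.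

Lemma dotp0r u : dotp u 0 = 0.
Proof. by rewrite /dotp big1 // => i _; rewrite mxE mulr0. Qed.

Lemma dotp_sumr (I : finType) u (F : I -> 'rV[R]_d) :
  dotp u (\sum_i F i) = \sum_i dotp u (F i).
Proof.
exact: (big_morph (dotp u) (fun v w => dotpDr u v w) (dotp0r u)).
Qed.

Lemma dotp_ge0 u : 0 <= dotp u u.
Proof. by apply: sumr_ge0 => i _; rewrite -expr2 sqr_ge0. Qed.

Lemma sqr_enorm u : enorm u ^+ 2 = dotp u u.
Proof. by rewrite sqr_sqrtr// dotp_ge0. Qed.

Lemma sqr_dotpB u v : dotp (u - v) (u - v) = dotp u u - 2 * dotp u v + dotp v v.
Proof. by rewrite !(dotpDl, dotpDr, dotpNl, dotpNr) (dotpC v u); ring. Qed.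

(** Cauchy-Schwarz for a unit vector [v]: the residual of [u] after projection onto [v] has
    nonnegative squared norm. *)
Lemma dotp_sqr_le u v : enorm v = 1 -> dotp v u ^+ 2 <= dotp u u.
Proof.
move=> /(congr1 (fun s => s ^+ 2)); rewrite sqr_enorm expr1n => v1.
have := dotp_ge0 (u - dotp v u *: v).
rewrite !(dotpDl, dotpDr, dotpNl, dotpNr, dotpZl, dotpZr) v1 (dotpC u v).
by lra.
Qed.

End euclidean.

(** * Gaussian integrals and moment generating functions *)

Section normal_mgf.
Context {R : realType}.
Local Notation mu := (@lebesgue_measure R).
Local Notation normal_prob := (@normal_prob R).

(** The Radon-Nikodym derivative of the normal law and its density have the same integral over every
    measurable set, so they agree almost everywhere and may be exchanged under the integral. *)
Lemma ge0_integral_normal_prob (m s : R) (f : measurableTypeR R -> \bar R) :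
  (forall x, 0 <= f x)%E -> measurable_fun setT f ->
  (\int[normal_prob m s]_x f x = \int[mu]_x (f x * (normal_pdf m s x)%:E))%E.
Proof.
move=> f0 mf.
have dom := normal_prob_dominates m s.
have mpdf : measurable_fun setT (fun x => (normal_pdf m s x)%:E : \bar R).
  by apply/measurable_EFinP; exact: measurable_normal_pdf.
have iRN := Radon_Nikodym_SigmaFinite.f_integrable dom.
rewrite -(Radon_Nikodym_SigmaFinite.change_of_variables dom f0)//.
apply: ae_eq_integral => //.
- by apply: emeasurable_funM => //; exact: (measurable_int mu).
- exact: emeasurable_funM.
- apply: ae_eqe_mul2l; apply: integral_ae_eq => //.
  by move=> E _ mE; rewrite -Radon_Nikodym_SigmaFinite.f_integral.
Qed.

Lemma normal_mgf (a : R) :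
  (\int[normal_prob 0 1]_x (expR (a * x))%:E = (expR (a ^+ 2 / 2))%:E)%E.
Proof.
rewrite ge0_integral_normal_prob//; last first.
  by apply/measurable_EFinP; apply: measurableT_comp => //; exact: measurable_funM.
under eq_integral => x _.
  rewrite -EFinM.
  (* Completing the square: tilting the standard normal density by [expR (a * x)] moves its mean to
     [a]. *)
  rewrite (_ : expR (a * x) * normal_pdf 0 1 x =
    expR (a ^+ 2 / 2) * normal_pdf a 1 x); last first.
    rewrite /normal_pdf oner_eq0 mulrCA [RHS]mulrCA; congr (_ * _).
    rewrite /normal_fun -!expRD; congr expR.
    rewrite expr1n subr0.
    by field.
  rewrite EFinM.
  over.
rewrite integralZl//; last exact: integrable_normal_pdf.
by rewrite integral_normal_pdf mule1.
Qed.

End normal_mgf.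

Section gaussian_mgf.
Context {R : realType}.

Lemma measurable_dotp (d : nat) (dT : measure_display) (T : measurableType dT)
    (f g : T -> 'rV[R]_d) :
  measurable_fun setT f -> measurable_fun setT g ->
  measurable_fun setT (fun x => dotp (f x) (g x)).
Proof.
move=> mf mg; apply: measurable_sum => i; apply: measurable_funM.
- exact: (measurableT_comp (measurable_coord i) mf).
- exact: (measurableT_comp (measurable_coord i) mg).
Qed.

(** The induction follows the recursive definition of [std_gaussian]: by Tonelli the exponential
    splits into a factor in the first coordinate and one in the remaining coordinates. *)
Lemma gaussian_mgf (d : nat) (a : 'rV[R]_d) :
  (\int[std_gaussian d]_z (expR (dotp a z))%:E = (expR (dotp a a / 2))%:E)%E.
Proof.
elim: d a => [|d IH] a.
  rewrite /= integral_dirac//=; last first.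
    apply/measurable_EFinP; apply: measurableT_comp => //.
    by apply: measurable_dotp.
  by rewrite diracT mul1e /dotp !big_ord0 mul0r.
rewrite /= ge0_integral_distribution//; last first.
  apply/measurable_EFinP; apply: measurableT_comp => //.
  exact: measurable_dotp.
pose a' : 'rV[R]_d := \row_i a 0 (lift ord0 i).
have dotpE (p : R * 'rV[R]_d) :
    dotp a (rV_cons p) = a 0 ord0 * p.1 + dotp a' p.2.
  rewrite /dotp big_ord_recl rV_cons0; congr (_ + _).
  by apply: eq_bigr => i _; rewrite rV_consS mxE.
have -> : dotp a a = a 0 ord0 ^+ 2 + dotp a' a'.
  rewrite /dotp big_ord_recl expr2; congr (_ + _).
  by apply: eq_bigr => i _; rewrite !mxE.
rewrite fubini_tonelli1//=; last first.
  apply/measurable_EFinP; apply: measurableT_comp => //=.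
  by apply: measurable_dotp => //; exact: measurable_rV_cons.
rewrite /fubini_F.
under eq_integral => x _.
  under eq_integral => z _ do rewrite /= dotpE expRD /= EFinM.
  rewrite ge0_integralZl//=; last first.
    apply/measurable_EFinP; apply: measurableT_comp => //.
    exact: measurable_dotp.
  rewrite IH.
  over.
rewrite ge0_integralZr//=; last first.
  by apply/measurable_EFinP; apply: measurableT_comp => //; exact: measurable_funM.
by rewrite normal_mgf -EFinM -expRD mulrDl.
Qed.

End gaussian_mgf.

(** * Log-Sobolev inequality and Laplace transform of squared distances *)

Lemma Lnorm2E (dT : measure_display) (T : measurableType dT) (R : realType)
    (mu : {measure set T -> \bar R}) (f : T -> R) :
  Lnorm mu 2%:E (EFin \o f) = ((\int[mu]_x (f x ^+ 2)%:E) `^ 2^-1)%E.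
Proof.
rewrite unlock; congr (_ `^ _)%E; apply: eq_integral => x _.
by rewrite [LHS]/= powR_mulrn// real_normK// num_real.
Qed.

Section log_sobolev_laplace.
Context {R : realType} {d : nat}.
Variables (pi : probability 'rV[R]_d R) (y : 'rV[R]_d).
Local Notation q := (fun x : 'rV[R]_d => dotp (x - y) (x - y)).

Lemma differentiable_sqdist x : differentiable q x.
Proof.
rewrite (_ : q = \sum_(i < d) (fun x : 'rV[R]_d => (x 0 i - y 0 i) * (x 0 i - y 0 i))).
  apply: differentiable_sum => i; apply: differentiableM;
    apply: differentiableB => //; exact: differentiable_coord.
apply/funext => z; rewrite fct_sumE; apply: eq_bigr => i _.
by rewrite !mxE.
Qed.

Lemma differentiable_expR_sqdist s x :
  differentiable (fun x => expR (- (s * q x))) x.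
Proof.
apply: (@differentiable_comp _ _ _ _ q (fun r => expR (- (s * r)))).
  exact: differentiable_sqdist.
by apply/derivable1_diffP.
Qed.

Lemma gradient_expR_sqdist s x :
  gradient (fun x => expR (- (s * q x))) x =
  (- (2 * s) * expR (- (s * q x))) *: (x - y).
Proof.
apply/rowP => i; rewrite !mxE.
set e : 'rV[R]_d := delta_mx 0 i.
have dote z : dotp z e = z 0 i.
  rewrite /dotp (bigD1 i)//= big1 => [|j ji]; rewrite mxE eqxx ?eqxx ?mulr1 ?addr0//.
  by rewrite (negbTE ji) mulr0.
(* Along the [i]-th basis vector the squared distance is a quadratic polynomial in [h], so the
   partial derivative is an ordinary derivative at 0. *)
pose phi h := expR (- (s * (q x + 2 * h * (x 0 i - y 0 i) + h ^+ 2))).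
have phiE h : expR (- (s * q (h *: e + x))) = phi h.
  rewrite /phi; congr (expR (- (s * _))).
  have -> : x 0 i - y 0 i = (x - y) 0 i by rewrite !mxE.
  rewrite -addrA; move: (x - y) => w.
  rewrite dotpDl !dotpDr !dotpZl !dotpZr (dotpC e) !dote mxE !eqxx/=.
  by ring.
pose f z := expR (- (s * q z)).
have phi0 : phi 0 = f x by rewrite -phiE scale0r add0r.
transitivity (derive1 phi 0).
  rewrite /derive /derive1 phi0.
  rewrite (_ : (fun h : R => h^-1 *: (phi (h + 0) - f x)) =
    fun h : R => h^-1 *: ((f \o shift x) (h *: e) - f x))//.
  by apply/funext => h /=; rewrite addr0 -phiE.
rewrite derive1E.
have : is_derive (0 : R) 1 phi
    (expR (- (s * q x)) * - (s * (2 * (x 0 i - y 0 i)))).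
  apply: is_derive_eq.
  rewrite /= !(mulr0, mul0r, addr0, expr0n)/=.
  by rewrite /GRing.scale/=; ring.
case=> _ ->.
by ring.
Qed.

Lemma C1_expR_sqdist s : C1 (fun x => expR (- (s * q x))).
Proof.
split=> [x|]; first exact: differentiable_expR_sqdist.
rewrite (_ : gradient _ = fun x => (- (2 * s) * expR (- (s * q x))) *: (x - y)).
  move=> x; have fc := differentiable_continuous (differentiable_expR_sqdist s x).
  exact: (cvgZ (cvgM (cvg_cst (- (2 * s))) fc) (cvgB cvg_id (cvg_cst y))).
by apply/funext => x; exact: gradient_expR_sqdist.
Qed.

Lemma measurable_sqdist : measurable_fun setT q.
Proof.
apply: measurable_dotp; apply: measurable_fun_rVP => i;
  under eq_fun do rewrite !mxE;
  by apply: measurable_funB => //; exact: measurable_coord.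
Qed.

Lemma measurable_expR_sqdist s : measurable_fun setT (fun x => expR (- (s * q x))).
Proof.
apply: measurableT_comp => //; apply: measurableT_comp => //.
by apply: measurable_funM => //; exact: measurable_sqdist.
Qed.

Lemma bounded_sqr_L2 (f : 'rV[R]_d -> R) (M : R) :
  measurable_fun setT f -> (forall x, f x ^+ 2 <= M) -> L2 pi f.
Proof.
move=> mf fM; rewrite /L2; apply/andP; split; rewrite inE//=.
rewrite /finite_norm Lnorm2E poweR_lty//.
apply: (@le_lt_trans _ _ (\int[pi]_x M%:E)%E).
  apply: ge0_le_integral => //=.
  - by move=> x _; rewrite lee_fin sqr_ge0.
  - by apply/measurable_EFinP; exact: measurable_funX.
  - by move=> x _; rewrite lee_fin.
rewrite integral_cst//= probability_setT mule1 ltry//.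
Qed.

Lemma sqdist_expR_ge0 (l : R) x : 0 <= q x * expR (- (l * q x)).
Proof. by rewrite mulr_ge0 ?dotp_ge0 ?expR_ge0. Qed.

(** This is [s <= expR s] at [s = l * q x]. The bound is uniform in [x] and supplies every
    domination below. *)
Lemma sqdist_expR_le (l : R) x : 0 < l -> q x * expR (- (l * q x)) <= l^-1.
Proof.
move=> l0; rewrite expRN ler_pdivrMr ?expR_gt0// mulrC ler_pdivlMr// mulrC.
by apply: le_trans (expR_ge1Dx _); rewrite lerDr ler01.
Qed.

Lemma measurable_sqdist_expR (l : R) :
  measurable_fun setT (fun x => q x * expR (- (l * q x))).
Proof.
by apply: measurable_funM; [exact: measurable_sqdist|exact: measurable_expR_sqdist].
Qed.

Lemma integrable_expR_sqdist (l : R) : 0 <= l ->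
  pi.-integrable setT (fun x => (expR (- (l * q x)))%:E).
Proof.
move=> l0; apply: (@le_integrable _ _ _ pi setT _ _ (cst 1%E)) => //.
- by apply/measurable_EFinP; exact: measurable_expR_sqdist.
- move=> x _; rewrite /= lee_fin normr1 ger0_norm ?expR_ge0//.
  by rewrite -expR0 ler_expR oppr_le0 mulr_ge0 ?dotp_ge0.
- exact: finite_measure_integrable_cst.
Qed.

Lemma integrable_sqdist_expR (l : R) : 0 < l ->
  pi.-integrable setT (fun x => (q x * expR (- (l * q x)))%:E).
Proof.
move=> l0; apply: (@le_integrable _ _ _ pi setT _ _ (cst (l^-1)%:E)) => //.
- by apply/measurable_EFinP; exact: measurable_sqdist_expR.
- move=> x _; rewrite /= lee_fin ger0_norm ?sqdist_expR_ge0//.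
  by apply: (le_trans (sqdist_expR_le x l0)); exact: ler_norm.
- exact: finite_measure_integrable_cst.
Qed.

Definition laplace_sqdist l : R := \int[pi]_x expR (- (l * q x)).

(** Minus the derivative of [laplace_sqdist] in [l], for [l > 0]. *)
Definition laplace_sqdist' l : R := \int[pi]_x (q x * expR (- (l * q x))).

Local Notation F := laplace_sqdist.
Local Notation M := laplace_sqdist'.

Lemma L2_cvg_cst (f : 'rV[R]_d -> R) : L2_cvg pi (fun=> f) f.
Proof.
rewrite /L2_cvg (_ : (fun k : nat => _) = fun=> 0%E); first exact: cvg_cst.
apply/funext => _; rewrite (_ : (fun x => _) = cst 0%E); first by rewrite Lnorm0.
by apply/funext => x; rewrite subrr.
Qed.

(** The function is bounded and [C1] with bounded gradient, so the constant sequence serves as its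
    approximation. *)
Lemma W12_expR_sqdist s : 0 < s ->
  let f x := expR (- (s * q x)) in W12 pi f (gradient f).
Proof.
move=> s0 f.
have L2f : L2 pi f.
  apply: (@bounded_sqr_L2 _ 1); first exact: measurable_expR_sqdist.
  move=> x; rewrite expr_le1 ?expR_ge0// -expR0 ler_expR oppr_le0.
  by rewrite mulr_ge0 ?dotp_ge0 ?ltW.
have L2g : L2_vec pi (gradient f).
  move=> i; rewrite (_ : (fun x => _) =
    (fun x => (- (2 * s) * expR (- (s * q x))) * (x 0 i - y 0 i))).
    (* The squared coordinate is at most [(2 s)^2 q exp (- 2 s q)], and
       [q exp (- 2 s q) <= 1 / (2 s)]. *)
    apply: (@bounded_sqr_L2 _ (2 * s)).
      apply: measurable_funM.
        by apply: measurable_funM => //; exact: measurable_expR_sqdist.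
      by apply: measurable_funB => //; exact: measurable_coord.
    move=> x.
    have xq : (x 0 i - y 0 i) ^+ 2 <= q x.
      rewrite /dotp (bigD1 i)//= !mxE -expr2 lerDl.
      by apply: sumr_ge0 => j _; rewrite -expr2 sqr_ge0.
    have s20 : 0 < 2 * s by rewrite mulr_gt0.
    have := sqdist_expR_le x s20.
    rewrite (_ : expR (- (2 * s * q x)) = expR (- (s * q x)) ^+ 2); last first.
      by rewrite -expRM_natl; congr expR; ring.
    rewrite -(ler_pM2l (exprn_gt0 2 s20)) => le1.
    rewrite [leRHS](_ : _ = (2 * s) ^+ 2 * (2 * s)^-1); last first.
      by rewrite expr2 mulfK// gt_eqF.
    apply: le_trans le1; rewrite !exprMn sqrrN -exprMn -mulrA ler_pM2l ?exprn_gt0//.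
    by rewrite mulrC ler_wpM2r// sqr_ge0.
  by apply/funext => x; rewrite gradient_expR_sqdist !mxE.
split => //; exists (fun=> f); split => [k||i].
- by split => //; exact: C1_expR_sqdist.
- exact: L2_cvg_cst.
- exact: L2_cvg_cst.
Qed.

(** The test function [exp (- l q / 2)] has square [exp (- l q)]. Its entropy is
    [- l * M l - F l * ln (F l)] and its gradient has squared norm [l ^+ 2 * q * exp (- l q)]. *)
Lemma log_sobolev_laplace (C l : R) : log_sobolev pi C -> 0 < l ->
  - (F l * ln (F l)) <= (l + 2 * C * l ^+ 2) * M l.
Proof.
move=> LSI l0; have l20 : 0 < l / 2 by rewrite divr_gt0.
have := LSI _ _ (W12_expR_sqdist l20).
have sqr x : expR (- (l / 2 * q x)) ^+ 2 = expR (- (l * q x)).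
  by rewrite -expRM_natl; congr expR; field.
have entE : (\int[pi]_x (expR (- (l / 2 * q x)) ^+ 2 *
    ln (expR (- (l / 2 * q x)) ^+ 2))%:E = (- l * M l)%:E)%E.
  transitivity (\int[pi]_x ((- l)%:E * (q x * expR (- (l * q x)))%:E))%E.
    apply: eq_integral => x _; rewrite -EFinM; congr EFin.
    by rewrite sqr expRK; ring.
  rewrite integralZl//; last exact: integrable_sqdist_expR.
  rewrite [RHS]EFinM /laplace_sqdist' /Rintegral fineK// integrable_fin_num//.
  exact: integrable_sqdist_expR.
have massE : fine (\int[pi]_x (expR (- (l / 2 * q x)) ^+ 2)%:E)%E = F l.
  by congr fine; apply: eq_integral => x _; rewrite sqr.
have gradE : (\int[pi]_x (enorm (gradient (fun x => expR (- (l / 2 * q x))) x)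
    ^+ 2)%:E = (l ^+ 2 * M l)%:E)%E.
  transitivity (\int[pi]_x ((l ^+ 2)%:E * (q x * expR (- (l * q x)))%:E))%E.
    apply: eq_integral => x _; rewrite -EFinM; congr EFin.
    rewrite gradient_expR_sqdist sqr_enorm dotpZl dotpZr -sqr.
    by field.
  rewrite integralZl//; last exact: integrable_sqdist_expR.
  rewrite [RHS]EFinM /laplace_sqdist' /Rintegral fineK// integrable_fin_num//.
  exact: integrable_sqdist_expR.
rewrite /entropy_sq unlock /= entE massE gradE -EFinM -EFinD lee_fin.
by lra.
Qed.

End log_sobolev_laplace.

(** * Integration of the differential inequality for the Laplace transform *)

Section laplace_sqdist_bound.
Context {R : realType} {d : nat}.
Variables (pi : probability 'rV[R]_d R) (y : 'rV[R]_d).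
Local Notation q := (fun x : 'rV[R]_d => dotp (x - y) (x - y)).
Local Notation F := (laplace_sqdist pi y).
Local Notation M := (laplace_sqdist' pi y).

(** Differentiation under the integral: for parameters between [l / 2] and [2 * l] the derivative of
    the integrand is dominated by the constant [(l / 2)^-1], which is integrable for a
    probability. *)
Lemma is_derive_laplace_sqdist (l : R) : 0 < l -> is_derive l 1 F (- M l).
Proof.
move=> l0; have l20 : 0 < l / 2 by rewrite divr_gt0.
have Il : `]l / 2, 2 * l[%classic l by rewrite /= in_itv/=; apply/andP; lra.
pose f (l : R) x := expR (- (l * q x)).
have derf (r : R) x : is_derive r 1 (f^~ x) (- (q x * f r x)).
  by apply: is_derive_eq; rewrite /GRing.scale/= /f; ring.
have d1f (r : R) x : partial1of2 f r x = - (q x * f r x).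
  by rewrite partial1of2E; exact: derive_val.
have intf (r : R) : `]l / 2, 2 * l[%classic r ->
    pi.-integrable setT (EFin \o f r).
  rewrite /= in_itv/= => /andP[lr _].
  by apply: integrable_expR_sqdist; apply: ltW; apply: lt_trans lr.
have derf1 (r : R) (x : 'rV[R]_d) : `]l / 2, 2 * l[%classic r -> setT x ->
    derivable (f^~ x) r 1.
  by move=> _ _; exact: ex_derive.
have intG : pi.-integrable setT (EFin \o cst (l / 2)^-1).
  exact: finite_measure_integrable_cst.
have G0 (x : 'rV[R]_d) : 0 <= cst (l / 2)^-1 x by rewrite invr_ge0 ltW.
have G_ub (r : R) (x : 'rV[R]_d) : `]l / 2, 2 * l[%classic r -> setT x ->
    `|partial1of2 f r x| <= cst (l / 2)^-1 x.
  rewrite /= in_itv/= => /andP[lr _] _.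
  have r0 := lt_trans l20 lr.
  rewrite d1f normrN ger0_norm ?sqdist_expR_ge0//.
  apply: le_trans (sqdist_expR_le y x r0) _.
  by rewrite lef_pV2 ?posrE// ltW.
apply: DeriveDef.
  exact: (derivable_under_integral measurableT Il intf derf1 G0 intG G_ub).
rewrite -derive1E.
rewrite (differentiation_under_integral measurableT Il intf derf1 G0 intG G_ub).
rewrite /laplace_sqdist' -[RHS]mulN1r -RintegralZl//; last exact: integrable_sqdist_expR.
by apply: eq_Rintegral => x _; rewrite d1f mulN1r.
Qed.

(** If the integral vanished, its positive integrand would be zero almost everywhere, and the whole
    space would be a null set. *)
Lemma laplace_sqdist_gt0 (l : R) : 0 < l -> 0 < F l.
Proof.
move=> l0; have F_ge0 : 0 <= F l by apply: Rintegral_ge0 => x _; exact: expR_ge0.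
rewrite lt_neqAle F_ge0 andbT eq_sym; apply/eqP => F0.
have mE : measurable_fun setT (fun x => (expR (- (l * q x)))%:E).
  by apply/measurable_EFinP; exact: measurable_expR_sqdist.
have : (\int[pi]_x `|(expR (- (l * q x)))%:E| = 0)%E.
  under eq_integral do rewrite gee0_abs ?lee_fin ?expR_ge0//.
  rewrite -[LHS]fineK; first by rewrite -[RHS]/(0%:E) -F0.
  by rewrite integrable_fin_num//; exact: integrable_expR_sqdist (ltW l0).
move=> /(ae_eq_integral_abs _ measurableT mE)[N [mN N0 subN]].
suff : pi setT = 0%E by rewrite probability_setT => /eqP; rewrite onee_eq0.
rewrite -N0; congr (pi _); apply/seteqP; split => // x _; apply: subN.
by move=> /= h; have /eqP := h I; rewrite eqe gt_eqF ?expR_gt0.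
Qed.

Lemma laplace_sqdist'_ge0 (l : R) : 0 <= M l.
Proof. by apply: Rintegral_ge0 => x _; exact: sqdist_expR_ge0. Qed.

(** Integrates [s * exp (- s) <= 1 - exp (- s)] at [s = l * q x], that is, [1 + s <= exp s]. *)
Lemma laplace_sqdist'_le (l : R) : 0 < l -> l * M l <= 1 - F l.
Proof.
move=> l0.
have i1 : pi.-integrable setT (EFin \o cst 1) by exact: finite_measure_integrable_cst.
have iF := integrable_expR_sqdist pi y (ltW l0).
have iM := integrable_sqdist_expR pi y l0.
have -> : 1 = \int[pi]_x (cst 1 x) :> R.
  by rewrite Rintegral_cst//= probability_setT mulr1.
rewrite -RintegralB// -RintegralZl//; apply: le_Rintegral => //.
- exact: (integrableZl measurableT l iM).
- exact: (integrableB measurableT i1 iF).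
- move=> x _ /=; rewrite lerBrDr mulrA -[X in _ + X]mul1r -mulrDl expRN.
  by rewrite ler_pdivrMr ?expR_gt0// mul1r addrC expR_ge1Dx.
Qed.

(** The derivative of [K] has a positive denominator and the numerator [(l + 2 * C * l ^+ 2) * M l +
    F l * ln (F l)], which is nonnegative by [log_sobolev_laplace]. *)
Lemma log_laplace_sqdist_nondecreasing (C a b : R) : 0 < C ->
    log_sobolev pi C -> 0 < a -> a <= b ->
  - ln (F a) * (a^-1 + 2 * C) <= - ln (F b) * (b^-1 + 2 * C).
Proof.
move=> C0 LSI a0 ab.
pose K (l : R) := - ln (F l) * (l^-1 + 2 * C).
have dK (l : R) : 0 < l -> is_derive l 1 K
    (M l / F l * (l^-1 + 2 * C) + ln (F l) / l ^+ 2).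
  move=> l0; have F0 := laplace_sqdist_gt0 l0.
  have dF := is_derive_laplace_sqdist l0.
  have dln := is_derive1_comp (is_derive1_ln F0) dF.
  have l_neq0 : l != 0 by rewrite gt_eqF.
  have dV : is_derive l 1 (fun l : R => l^-1) (- l ^- 2).
    by apply: (is_derive_eq (is_deriveV l_neq0 (is_derive_id l 1)));
      rewrite /GRing.scale/= mulr1.
  apply: (is_derive_eq (is_deriveM (is_deriveN dln)
    (is_deriveD dV (is_derive_cst (2 * C) l 1)))).
  rewrite /GRing.scale/= !fctE/=.
  have F_neq0 : F l != 0 by rewrite gt_eqF.
  by field; apply/andP.
have [derK K'] : (forall l : R, 0 < l -> derivable K l 1) /\
    (forall l, 0 < l -> K^`()%classic l =
      M l / F l * (l^-1 + 2 * C) + ln (F l) / l ^+ 2).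
  by split=> l /dK h; [exact: ex_derive|rewrite derive1E; exact: derive_val].
apply: (@ger0_derive1_le_cc R K a b) => //.
- by move=> l; rewrite in_itv/= => /andP[al _]; apply: derK; exact: lt_trans al.
- move=> l; rewrite in_itv/= => /andP[al _].
  have l0 := lt_trans a0 al; have F0 := laplace_sqdist_gt0 l0.
  rewrite K'//.
  rewrite (_ : _ + _ = ((l + 2 * C * l ^+ 2) * M l + F l * ln (F l)) /
      (F l * l ^+ 2)); last by field; rewrite !gt_eqF.
  rewrite divr_ge0//; last by rewrite mulr_ge0 ?sqr_ge0 ?ltW.
  by rewrite -lerBlDr sub0r log_sobolev_laplace.
- apply: derivable_within_continuous => l; rewrite in_itv/= => /andP[al _].
  by apply: derK; exact: lt_le_trans al.
- by rewrite in_itv/= lexx.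
- by rewrite in_itv/= lexx ab.
Qed.

(** Replaces the limit of the monotone quantity at 0 by a bound at each [a > 0]:
    [a * M a <= 1 - F a <= - ln (F a)], so its value at [a] is already at least [M a]. *)
Lemma laplace_sqdist'_le_log (C a b : R) : 0 < C ->
    log_sobolev pi C -> 0 < a -> a <= b ->
  M a <= - ln (F b) * (b^-1 + 2 * C).
Proof.
move=> C0 LSI a0 ab.
apply: le_trans (log_laplace_sqdist_nondecreasing C0 LSI a0 ab).
have F0 := laplace_sqdist_gt0 a0.
have F1 : ln (F a) <= F a - 1.
  by rewrite -ler_expR lnK ?posrE// -[leLHS]addr0 -(subrr 1) addrCA expR_ge1Dx.
have aM := laplace_sqdist'_le a0.
have M0 := laplace_sqdist'_ge0 a.
have lnF : a * M a <= - ln (F a) by lra.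
have lnF0 : 0 <= - ln (F a) by apply: le_trans lnF; rewrite mulr_ge0// ltW.
have C20 : 0 <= 2 * C by rewrite mulr_ge0// ltW.
rewrite mulrDr -[leLHS]addr0; apply: lerD; last exact: mulr_ge0.
by rewrite ler_pdivlMr// mulrC.
Qed.

(** Monotone convergence along [b / n.+1]: as the parameter decreases to 0, the integrands of [M]
    increase to the squared distance, while the bound depends on [b] alone. *)
Lemma integral_sqdist_le_log (C b : R) : 0 < C -> log_sobolev pi C -> 0 < b ->
  (\int[pi]_x (q x)%:E <= (- ln (F b) * (b^-1 + 2 * C))%:E)%E.
Proof.
move=> C0 LSI b0.
pose a n : R := b / n.+1%:R.
have a0 n : 0 < a n by rewrite divr_gt0.
pose g n x := (q x * expR (- (a n * q x)))%:E.
have mg n : measurable_fun setT (g n).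
  by apply/measurable_EFinP; exact: measurable_sqdist_expR.
have g0 n x : setT x -> (0 <= g n x)%E.
  by move=> _; rewrite lee_fin; exact: sqdist_expR_ge0.
have ndg x : setT x -> {homo g^~ x : n m / (n <= m)%N >-> (n <= m)%E}.
  move=> _ n m nm; rewrite lee_fin ler_wpM2l ?dotp_ge0// ler_expR lerN2.
  by rewrite ler_wpM2r ?dotp_ge0// ler_pM2l// lef_pV2 ?posrE// ler_nat.
have cg x : g ^~ x @ \oo --> (q x)%:E.
  apply: cvg_EFin; first exact: nearW.
  rewrite -[X in _ --> X]mulr1; apply: cvgM; first exact: cvg_cst.
  rewrite -expR0; apply: continuous_cvg; first exact: continuous_expR.
  rewrite -oppr0; apply: cvgN; rewrite -(mul0r (q x)).
  apply: cvgM; last exact: cvg_cst.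
  rewrite -(mulr0 b); apply: cvgM; first exact: cvg_cst.
  exact: cvg_harmonic.
have <- : (\int[pi]_x limn (g^~ x) = \int[pi]_x (q x)%:E)%E.
  by apply: eq_integral => x _; exact: cvg_lim.
have cvgI := @cvg_monotone_convergence _ _ _ pi _ measurableT _ mg g0 ndg.
rewrite -(cvg_lim _ cvgI)//; apply: lime_le; first by apply/cvg_ex; eexists; exact: cvgI.
apply: nearW => n.
have an : a n <= b.
  by rewrite ler_pdivrMr// ler_peMr ?ler1n// ltW.
have := laplace_sqdist'_le_log C0 LSI (a0 n) an.
rewrite -lee_fin /laplace_sqdist' /Rintegral fineK// integrable_fin_num//.
exact: integrable_sqdist_expR.
Qed.

(** Solves the previous bound for [F b], using [b^-1 + 2 * C = (1 + 2 * C * b) / b]. *)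
Lemma laplace_sqdist_le (C b T : R) : 0 < C -> log_sobolev pi C -> 0 < b ->
  (T%:E <= \int[pi]_x (q x)%:E)%E ->
  F b <= expR (- (b * T / (1 + 2 * C * b))).
Proof.
move=> C0 LSI b0 /le_trans /(_ (integral_sqdist_le_log C0 LSI b0)).
rewrite lee_fin => TF.
have F0 := laplace_sqdist_gt0 b0.
have D0 : 0 < 1 + 2 * C * b by rewrite addr_gt0// mulr_gt0// mulr_gt0.
rewrite -[leLHS]lnK ?posrE// ler_expR lerNr ler_pdivrMr//.
rewrite -ler_pdivlMl// (le_trans TF)// le_eqVlt; apply/orP; left; apply/eqP.
by field; rewrite gt_eqF.
Qed.

End laplace_sqdist_bound.

(** * Moments and independent pairs *)

Section moments.
Context {R : realType} {d : nat}.

Lemma trace_le_integral_sqdist (pi : probability 'rV[R]_d R) (Sigma : 'M[R]_d)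
    (y : 'rV[R]_d) : has_mean_cov pi 0 Sigma ->
  ((\tr Sigma)%:E <= \int[pi]_x (dotp (x - y) (x - y))%:E)%E.
Proof.
move=> [L2c Ec covc].
have ci i : pi.-integrable setT (fun x => (x 0 i)%:E).
  by apply/Lfun1_integrable; apply: (Lfun_subset12 _ (L2c i)); exact: fin_num_measure.
have ci2 i : pi.-integrable setT (fun x => (x 0 i ^+ 2)%:E).
  exact: (Lfun2_integrable_sqr (L2c i)).
have Ii i : (\int[pi]_x (x 0 i)%:E = 0)%E.
  by have := Ec i; rewrite unlock mxE.
have Ii2 i : (\int[pi]_x (x 0 i ^+ 2)%:E = (Sigma i i)%:E)%E.
  rewrite -covc unlock Ec mxE/= unlock.
  apply: eq_integral => x _; congr EFin.
  by rewrite /= /Defs.coord !fctE/= subr0.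
rewrite /mxtrace -sumEFin.
have -> : (\int[pi]_x (dotp (x - y) (x - y))%:E =
    \sum_i \int[pi]_x ((x 0 i - y 0 i) ^+ 2)%:E)%E.
  rewrite -ge0_integral_sum//=.
  - by apply: eq_integral => x _; rewrite sumEFin; congr EFin;
      apply: eq_bigr => i _; rewrite !mxE expr2.
  - move=> i; apply/measurable_EFinP; apply: measurable_funX.
    by apply: measurable_funB => //; exact: measurable_coord.
  - by move=> i x _; rewrite lee_fin sqr_ge0.
apply: lee_sum => i _.
have iy : pi.-integrable setT (fun x => (2 * y 0 i)%:E * (x 0 i)%:E)%E.
  exact: integrableZl.
(* Since the mean is 0, subtracting the linear term leaves the integral unchanged, and the integrand
   becomes [(x 0 i - y 0 i) ^+ 2] minus the square of [y 0 i]. *)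
have -> : ((Sigma i i)%:E =
    \int[pi]_x ((x 0 i ^+ 2)%:E - (2 * y 0 i)%:E * (x 0 i)%:E))%E.
  by rewrite integralB// integralZl// Ii Ii2 mule0 sube0.
apply: le_integral => //.
- exact: integrableB.
- have := integrableD measurableT (integrableB measurableT (ci2 i) iy)
    (finite_measure_integrable_cst pi (y 0 i ^+ 2) measurableT).
  apply: eq_integrable => // x _.
  by rewrite /= -EFinD; congr EFin; ring.
- move=> x _; rewrite -EFinM -EFinB lee_fin.
  by have := sqr_ge0 (y 0 i); lra.
Qed.

End moments.

(** * Joint law of two distinct samples *)

Section pairs.
Context {R : realType} {dO dT : measure_display} {Omega : measurableType dO}
  {T : measurableType dT}.
Variables (P : probability Omega R) (pi : probability T R).

Lemma iid_pair (n : nat) (X : 'I_n -> {RV P >-> T}) (j k : 'I_n) (A B : set T) :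
  iid pi X -> j != k -> measurable A -> measurable B ->
  P (X j @^-1` A `&` X k @^-1` B) = (pi A * pi B)%E.
Proof.
move=> [law ind] jk mA mB.
pose C i := if i == j then A else B.
have mC i : measurable (C i) by rewrite /C; case: ifP.
have := ind [set j; k]%SET C mC.
rewrite (big_setD1 j) ?in_set2 ?eqxx//= (_ : [set j; k]%SET :\ j = [set k]%SET); last first.
  by apply/setP => i; rewrite !inE; case: eqVneq => // ->; rewrite (negbTE jk).
rewrite big_set1 {2 3}/C eqxx eq_sym (negbTE jk).
rewrite -(law j _ mA) -(law k _ mB) => <-.
congr (P _); apply/seteqP; split => w /=.
- move=> [Aj Bk] i; rewrite /= !inE /C => /orP[/eqP ->|/eqP ->]; first by rewrite eqxx.
  by rewrite eq_sym (negbTE jk).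
- move=> h; split.
  + by have := h j; rewrite /= !inE eqxx /C eqxx; apply.
  + by have := h k; rewrite /= !inE eqxx orbT /C eq_sym (negbTE jk); apply.
Qed.

(** The law of the pair agrees with the product measure on rectangles, hence everywhere. The second
    sample is integrated last, so that the inner integral has a fixed centre [y]. *)
Lemma ge0_integral_iid_pair (n : nat) (X : 'I_n -> {RV P >-> T}) (j k : 'I_n)
    (h : T * T -> \bar R) :
  iid pi X -> j != k -> measurable_fun setT h -> (forall p, 0 <= h p)%E ->
  (\int[P]_w h (X j w, X k w) = \int[pi]_y \int[pi]_x h (x, y))%E.
Proof.
move=> iidX jk mh h0.
have mXX : measurable_fun setT (fun w => (X j w, X k w)).
  by apply: measurable_fun_pair.
pose XX : {RV P >-> (T * T)%type} := HB.pack (fun w => (X j w, X k w))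
  (isMeasurableFun.Build _ _ _ _ _ mXX).
transitivity (\int[distribution P XX]_p h p)%E.
  by rewrite ge0_integral_distribution.
transitivity (\int[(pi \x pi)%E]_p h p)%E.
  apply: eq_measure_integral => E mE _; apply/esym.
  apply: product_measure_unique => // A B mA mB.
  exact: (iid_pair iidX jk mA mB).
by rewrite fubini_tonelli2.
Qed.

End pairs.

(** * Pointwise error of the empirical Bayes denoiser *)

Section measurable_denoiser.
Context {R : realType} {d n : nat}.
Variables (t : R) (dT : measure_display) (T : measurableType dT).
Variables (Y : 'I_n -> T -> 'rV[R]_d) (a : T -> 'rV[R]_d).
Hypothesis mY : forall i, measurable_fun setT (Y i).

Lemma measurable_rV_coord (f : T -> 'rV[R]_d) i :
  measurable_fun setT f -> measurable_fun setT (fun s => f s 0 i).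
Proof. by move=> mf; exact: (measurableT_comp (measurable_coord i) mf). Qed.

Lemma measurable_unnormalized_weight k :
  measurable_fun setT a ->
  measurable_fun setT (fun s => unnormalized_weight t (Y^~ s) k (a s)).
Proof.
move=> ma; apply: measurableT_comp => //; apply: measurableT_comp => //.
apply: measurable_funM => //; under eq_fun do rewrite sqr_enorm.
have mB : measurable_fun setT (fun s => rho t *: Y k s - a s).
  apply: measurable_fun_rVP => i; under eq_fun do rewrite !mxE.
  apply: measurable_funB; last exact: measurable_rV_coord.
  by apply: measurable_funM => //; exact: measurable_rV_coord.
exact: measurable_dotp.
Qed.

Lemma measurable_weight k : measurable_fun setT a ->
  measurable_fun setT (fun s => weight t (Y^~ s) k (a s)).
Proof.
move=> ma; apply: measurable_funM; first exact: measurable_unnormalized_weight.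
(* The normalizing sum is positive, so its inverse is [expR] of minus its logarithm, a composition
   of measurable functions. *)
have invE s : (\sum_j unnormalized_weight t (Y^~ s) j (a s))^-1 =
    expR (- ln (\sum_j unnormalized_weight t (Y^~ s) j (a s))).
  have W0 j : 0 < unnormalized_weight t (Y^~ s) j (a s) by exact: expR_gt0.
  rewrite expRN lnK// posrE (bigD1 k)//= ltr_wpDr// sumr_ge0// => j _.
  exact: ltW.
under eq_fun do rewrite invE.
apply: measurableT_comp => //; apply: measurableT_comp => //.
apply: measurableT_comp => //; apply: measurable_sum => j.
exact: measurable_unnormalized_weight.
Qed.

Lemma measurable_denoiser : measurable_fun setT a ->
  measurable_fun setT (fun s => denoiser t (Y^~ s) (a s)).
Proof.
move=> ma; apply: measurable_fun_rVP => i; under eq_fun do rewrite !mxE summxE.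
apply: measurable_funM => //; apply: measurable_sum => k.
under eq_fun do rewrite !mxE.
apply: measurable_funM; first exact: measurable_weight.
apply: measurable_funB; last exact: measurable_rV_coord.
by apply: measurable_funM => //; exact: measurable_rV_coord.
Qed.

End measurable_denoiser.

(** The samples may depend on the parameter [s]: this covers both fixed data with random noise and
    joint measurability in the data and the noise. *)
Lemma measurable_denoiser_error (R : realType) (d n : nat) (t : R)
    (dT : measure_display) (T : measurableType dT)
    (Y : 'I_n -> T -> 'rV[R]_d) (a z : T -> 'rV[R]_d) (v : 'rV[R]_d) :
  (forall i, measurable_fun setT (Y i)) ->
  measurable_fun setT a -> measurable_fun setT z ->
  measurable_fun setT (fun s =>
    denoiser_coord t (Y^~ s) v (a s, z s) - noise_coord v (a s, z s)).
Proof.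
move=> mY ma mz; apply: measurable_funB; last first.
  by apply: (measurableT_comp (@oppr_measurable R setT)); exact: measurable_dotp.
apply: measurable_dotp => //.
apply: (@measurable_denoiser _ _ _ t _ _ Y (fun s => rho t *: a s + sigma t *: z s)) => //.
apply: measurable_fun_rVP => i; under eq_fun do rewrite !mxE.
apply: measurable_funD; apply: measurable_funM => //; exact: measurable_rV_coord.
Qed.


Section denoiser_error.
Context {R : realType} {d n : nat}.
Variables (t : R) (t_gt0 : 0 < t).
Local Notation rho := (Defs.rho t).
Local Notation sigma := (Defs.sigma t).

Lemma rho_gt0 : 0 < rho. Proof. exact: expR_gt0. Qed.

Lemma sigma_gt0 : 0 < sigma.
Proof.
by rewrite sqrtr_gt0 subr_gt0 -[ltRHS]expR0 ltr_expR oppr_lt0 mulr_gt0.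
Qed.

Variables (x : 'I_n -> 'rV[R]_d) (v : 'rV[R]_d).

Lemma unnormalized_weight_gt0 j u : 0 < unnormalized_weight t x j u.
Proof. exact: expR_gt0. Qed.

Lemma unnormalized_weight_le_sum j u :
  unnormalized_weight t x j u <= \sum_i unnormalized_weight t x i u.
Proof.
by rewrite (bigD1 j)//= lerDl; apply: sumr_ge0 => i _; exact: expR_ge0.
Qed.

Lemma sum_unnormalized_weight_gt0 (k : 'I_n) u :
  0 < \sum_j unnormalized_weight t x j u.
Proof.
exact: lt_le_trans (unnormalized_weight_gt0 k u) (unnormalized_weight_le_sum k u).
Qed.

Lemma weight_ge0 j u : 0 <= weight t x j u.
Proof.
by rewrite divr_ge0 ?expR_ge0//; apply: sumr_ge0 => i _; exact: expR_ge0.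
Qed.

Lemma sum_weight (k : 'I_n) u : \sum_j weight t x j u = 1.
Proof. by rewrite -mulr_suml divff// gt_eqF// (sum_unnormalized_weight_gt0 k). Qed.

(** The weighted variance of [a] is nonnegative. The index [k] witnesses that there is a sample, so
    that the weights sum to 1. *)
Lemma jensen_weight (k : 'I_n) u (a : 'I_n -> R) :
  (\sum_j weight t x j u * a j) ^+ 2 <= \sum_j weight t x j u * a j ^+ 2.
Proof.
set m := \sum_j weight t x j u * a j; set s := leRHS.
have : 0 <= \sum_j weight t x j u * (a j - m) ^+ 2.
  by apply: sumr_ge0 => j _; rewrite mulr_ge0 ?weight_ge0 ?sqr_ge0.
have -> : \sum_j weight t x j u * (a j - m) ^+ 2 =
    \sum_j (weight t x j u * a j ^+ 2 +
      (- (2 * m) * (weight t x j u * a j) + m ^+ 2 * weight t x j u)).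
  by apply: eq_bigr => j _; ring.
rewrite !big_split/= -!mulr_sumr (sum_weight k) -/m -/s.
by lra.
Qed.

(* With [u = rho x_k + sigma z] the exponent is half of
   [log (unnormalized_weight j u / unnormalized_weight k u)], and
   [min 1 r <= sqrt r]. *)
Lemma weight_le (j k : 'I_n) (z : 'rV[R]_d) :
  weight t x j (rho *: x k + sigma *: z) <=
  expR (- (rho ^+ 2 / (4 * sigma ^+ 2) * dotp (x j - x k) (x j - x k))) *
  expR (dotp ((rho / (2 * sigma)) *: (x j - x k)) z).
Proof.
set u := rho *: x k + sigma *: z; rewrite -expRD; set e := expR _.
have s0 := sigma_gt0.
have We : unnormalized_weight t x j u = e ^+ 2 * unnormalized_weight t x k u.
  rewrite -expRM_natl -expRD; congr expR; rewrite !sqr_enorm.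
  have -> : rho *: x j - u = rho *: (x j - x k) - sigma *: z.
    by rewrite /u scalerBr opprD addrA.
  have -> : rho *: x k - u = - (sigma *: z) by rewrite /u opprD addrA subrr sub0r.
  move: (x j - x k) => D.
  rewrite sqr_dotpB !(dotpNl, dotpNr, dotpZl, dotpZr).
  by field; rewrite gt_eqF.
have S0 := sum_unnormalized_weight_gt0 k u.
rewrite /weight ler_pdivrMr//.
have [e1|/ltW e1] := leP e 1.
  rewrite We expr2 -mulrA ler_wpM2l ?expR_ge0//.
  apply: le_trans (unnormalized_weight_le_sum k u).
  by rewrite ler_piMl// ltW// unnormalized_weight_gt0.
apply: le_trans (unnormalized_weight_le_sum j u) _.
by rewrite ler_peMl// ltW.
Qed.

Lemma denoiser_coordB_noise_coord (k : 'I_n) (z : 'rV[R]_d) :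
  denoiser_coord t x v (x k, z) - noise_coord v (x k, z) =
  rho / sigma *
    \sum_j weight t x j (rho *: x k + sigma *: z) * dotp v (x j - x k).
Proof.
rewrite /denoiser_coord /noise_coord /denoiser opprK /=.
set u := rho *: x k + sigma *: z.
have s0 : sigma != 0 by rewrite gt_eqF ?sigma_gt0.
rewrite dotpZr dotp_sumr.
(* As the weights sum to 1, the noise term can be moved under the sum, where it cancels the noise
   contained in [u]. *)
have -> : dotp v z = sigma^-1 * \sum_j weight t x j u * (sigma * dotp v z).
  by rewrite -mulr_suml (sum_weight k) mul1r mulKf.
rewrite -mulrDr -big_split/= [rho / sigma]mulrC -mulrA; congr (_ * _).
rewrite [RHS]mulr_sumr; apply: eq_bigr => j _.
rewrite dotpZr -mulrDr mulrCA; congr (_ * _).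
rewrite /u !(dotpDr, dotpNr, dotpZr).
by ring.
Qed.

(** Jensen moves the square inside the weighted sum, Cauchy-Schwarz removes [v], and [weight_le]
    leaves an exponential that is linear in [z]. *)
Lemma sqr_denoiser_error_le (k : 'I_n) (z : 'rV[R]_d) : enorm v = 1 ->
  (denoiser_coord t x v (x k, z) - noise_coord v (x k, z)) ^+ 2 <=
  \sum_j ((rho / sigma) ^+ 2 * dotp (x j - x k) (x j - x k) *
    expR (- (rho ^+ 2 / (4 * sigma ^+ 2) * dotp (x j - x k) (x j - x k)))) *
    expR (dotp ((rho / (2 * sigma)) *: (x j - x k)) z).
Proof.
move=> v1; rewrite denoiser_coordB_noise_coord exprMn.
rewrite [leRHS](_ : _ = (rho / sigma) ^+ 2 * \sum_j dotp (x j - x k) (x j - x k) *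
    (expR (- (rho ^+ 2 / (4 * sigma ^+ 2) * dotp (x j - x k) (x j - x k))) *
    expR (dotp ((rho / (2 * sigma)) *: (x j - x k)) z))); last first.
  by rewrite [RHS]mulr_sumr; apply: eq_bigr => j _; rewrite !mulrA.
rewrite ler_wpM2l ?sqr_ge0//.
apply: le_trans (jensen_weight k _ _) _; apply: ler_sum => j _.
rewrite mulrC; apply: ler_pM; rewrite ?sqr_ge0 ?weight_ge0//.
  exact: dotp_sqr_le.
exact: weight_le.
Qed.

(** Half of the exponent absorbs the linear prefactor, by [s * D <= expR (s * D)]. *)
Lemma sqr_mul_expR_le (s D : R) : 0 < s -> 0 <= D ->
  16 * s * D * expR (- (2 * s * D)) <= 16 * expR (- (s * D)).
Proof.
move=> s0 D0; rewrite -!mulrA ler_pM2l// mulrA.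
rewrite (_ : - (2 * (s * D)) = - (s * D) + - (s * D)); last by ring.
rewrite expRD mulrA ler_piMl ?expR_ge0// expRN ler_pdivrMr ?expR_gt0// mul1r.
by apply: le_trans (expR_ge1Dx _); rewrite lerDr.
Qed.

Lemma integral_sqr_denoiser_error_le (k : 'I_n) : enorm v = 1 ->
  (\int[std_gaussian d]_z
    ((denoiser_coord t x v (x k, z) - noise_coord v (x k, z)) ^+ 2)%:E <=
  (\sum_(j | j != k) 16 *
    expR (- (rho ^+ 2 / (16 * sigma ^+ 2) * dotp (x j - x k) (x j - x k))))%:E)%E.
Proof.
move=> v1.
pose D j := dotp (x j - x k) (x j - x k).
have D0 j : 0 <= D j by exact: dotp_ge0.
pose A j := (rho / sigma) ^+ 2 * D j * expR (- (rho ^+ 2 / (4 * sigma ^+ 2) * D j)).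
have A0 j : 0 <= A j by rewrite mulr_ge0 ?expR_ge0// mulr_ge0 ?sqr_ge0.
pose B j z := expR (dotp ((rho / (2 * sigma)) *: (x j - x k)) z).
have mB j : measurable_fun setT (fun z => (B j z)%:E).
  apply/measurable_EFinP; apply: measurableT_comp => //.
  exact: measurable_dotp.
have s0 : sigma != 0 by rewrite gt_eqF// sigma_gt0.
apply: (@le_trans _ _ (\int[std_gaussian d]_z \sum_j ((A j)%:E * (B j z)%:E))%E).
  apply: ge0_le_integral => //.
  - by move=> z _; rewrite lee_fin sqr_ge0.
  - apply/measurable_EFinP; apply: measurable_funX.
    exact: (@measurable_denoiser_error _ _ _ t _ _ (fun i => cst (x i)) (cst (x k)) id).
  - by apply: emeasurable_sum => j; exact: measurable_funeM.
  - move=> z _; under eq_bigr do rewrite -EFinM.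
    by rewrite sumEFin lee_fin; exact: sqr_denoiser_error_le.
rewrite ge0_integral_sum//; last 2 first.
- by move=> j; exact: measurable_funeM.
- by move=> j z _; rewrite mule_ge0 ?lee_fin ?expR_ge0.
rewrite -sumEFin [leRHS]big_mkcond; apply: lee_sum => j _.
rewrite ge0_integralZl_EFin//; last by move=> z _; rewrite lee_fin expR_ge0.
(* The term [j = k] vanishes because its squared distance is 0. *)
rewrite gaussian_mgf -EFinM; case: eqVneq => [->|jk] /=.
  by rewrite lee_fin /A /D subrr dotp0r !(mulr0, mul0r).
rewrite lee_fin /A. rewrite -[leLHS]mulrA -expRD !(dotpZl, dotpZr) -/(D j).
(* The moment generating function contributes [rho^2 D / (8 sigma^2)], half of the decay
   [rho^2 D / (4 sigma^2)]. With [s = rho^2 / (16 sigma^2)] the remaining exponent is [- 2 s D], and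
   the prefactor is [16 s D]. *)
have l0 : 0 < rho ^+ 2 / (16 * sigma ^+ 2).
  by rewrite divr_gt0 ?mulr_gt0 ?exprn_gt0 ?rho_gt0 ?sigma_gt0.
apply: le_trans (sqr_mul_expR_le l0 (D0 j)).
rewrite le_eqVlt; apply/orP; left; apply/eqP; congr (_ * expR _); by field.
Qed.

End denoiser_error.

(** * Expected squared error *)

Lemma integral_empirical (R : realType) (d n : nat) (x : 'I_n -> 'rV[R]_d)
    (f : 'rV[R]_d -> \bar R) :
  measurable_fun setT f -> (forall y, 0 <= f y)%E ->
  (\int[empirical x]_y f y = (n%:R^-1)%:E * \sum_(k < n) f (x k))%E.
Proof.
move=> mf f0; rewrite ge0_integral_mscale//; congr (_ * _)%E.
rewrite ge0_integral_measure_sum//; apply: eq_bigr => k _.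
rewrite integral_dirac// diracT mul1e; congr f.
by rewrite /codom /image_mem (nth_map k) ?nth_ord_enum// size_enum_ord.
Qed.

(** Finiteness lets [empirical x] be packed as a finite measure for Tonelli's theorem. *)
Lemma fin_num_empirical (R : realType) (d n : nat) (x : 'I_n -> 'rV[R]_d) :
  fin_num_fun (empirical x).
Proof.
apply: lty_fin_num_fun; rewrite -[empirical x setT]mul1e -integral_cst//.
by rewrite integral_empirical// (eq_bigr (fun=> 1%:E))// sumEFin -EFinM ltry.
Qed.

Lemma integral_empirical_noise (R : realType) (d n : nat) (x : 'I_n -> 'rV[R]_d)
    (f : 'rV[R]_d * 'rV[R]_d -> \bar R) :
  measurable_fun setT f -> (forall p, 0 <= f p)%E ->
  (\int[empirical_noise x]_p f p =
   (n%:R^-1)%:E * \sum_(k < n) \int[std_gaussian d]_z f (x k, z))%E.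
Proof.
move=> mf f0.
pose m1 : {finite_measure set 'rV[R]_d -> \bar R} := HB.pack (Measure.sort (empirical x))
  (Measure_isFinite.Build _ _ _ (empirical x) (fin_num_empirical x)).
have := @fubini_tonelli1 _ _ _ _ R m1 (std_gaussian d) f mf f0.
have mF := @measurable_fun_fubini_tonelli_F _ _ _ _ R (std_gaussian d) f mf f0.
rewrite /= integral_empirical//; last by move=> y; apply: integral_ge0.
Qed.

Section expected_error.
Context {R : realType} {d n : nat} {dO : measure_display}
  {Omega : measurableType dO}.
Variables (t : R) (t_gt0 : 0 < t).
Variables (P : probability Omega R) (pi : probability 'rV[R]_d R).
Variables (X : 'I_n -> {RV P >-> 'rV[R]_d}) (v : 'rV[R]_d).

Definition sqr_error (w : Omega) : \bar R :=
  \int[empirical_noise (X^~ w)]_p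
    ((denoiser_coord t (X^~ w) v p - noise_coord v p) ^+ 2)%:E.

Let error2 (k : 'I_n) (w : Omega) (z : 'rV[R]_d) : \bar R :=
  ((denoiser_coord t (X^~ w) v (X k w, z) - noise_coord v (X k w, z)) ^+ 2)%:E.

Lemma sqr_errorE w :
  (sqr_error w = (n%:R^-1)%:E * \sum_(k < n) \int[std_gaussian d]_z error2 k w z)%E.
Proof.
rewrite /sqr_error integral_empirical_noise//; last first.
  by move=> p; rewrite lee_fin sqr_ge0.
apply/measurable_EFinP; apply: measurable_funX.
have := @measurable_denoiser_error R d n t _ _ (fun i => cst (X i w))
  (@fst 'rV[R]_d 'rV[R]_d) snd v.
under eq_fun => p do rewrite -surjective_pairing.
by apply.
Qed.

Lemma sqr_error_ge0 w : (0 <= sqr_error w)%E.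
Proof. by apply: integral_ge0 => p _; rewrite lee_fin sqr_ge0. Qed.

Lemma measurable_error2 k : measurable_fun setT (fun w =>
  \int[std_gaussian d]_z error2 k w z)%E.
Proof.
apply: (@measurable_fun_fubini_tonelli_F _ _ _ _ R (std_gaussian d)
    (fun p => error2 k p.1 p.2)); last by move=> p; rewrite lee_fin sqr_ge0.
apply/measurable_EFinP; apply: measurable_funX.
apply: (@measurable_denoiser_error R d n t _ _ (fun i p => X i p.1)
  (fun p => X k p.1) snd v) => //.
- by move=> i; apply: measurableT_comp.
- exact: measurableT_comp.
Qed.

Lemma measurable_sqr_error : measurable_fun setT sqr_error.
Proof.
rewrite (funext sqr_errorE); apply: measurable_funeM; apply: emeasurable_sum => k; exact: measurable_error2.
Qed.

(** For [j != k], integrating over [X j] with [X k] fixed gives a Laplace transform bounded by [B]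
    uniformly in the centre. Each [k] meets at most [n] such terms, and averaging over [k] preserves
    the bound. *)
Lemma expected_sqr_error_le (C : R) (Sigma : 'M[R]_d) :
  let l := rho t ^+ 2 / (16 * sigma t ^+ 2) in
  0 < C -> log_sobolev pi C -> has_mean_cov pi 0 Sigma -> iid pi X ->
  enorm v = 1 ->
  (\int[P]_w sqr_error w <=
   (16 * n%:R * expR (- (l * \tr Sigma / (1 + 2 * C * l))))%:E)%E.
Proof.
move=> l C0 LSI hmc iidX v1.
set B := expR _.
have l0 : 0 < l.
  by rewrite divr_gt0 ?mulr_gt0 ?exprn_gt0 ?rho_gt0 ?sigma_gt0.
pose h (p : 'rV[R]_d * 'rV[R]_d) := expR (- (l * dotp (p.1 - p.2) (p.1 - p.2))).
have h0 p : 0 <= h p by exact: expR_ge0.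
have mh : measurable_fun setT (fun p => (h p)%:E).
  apply/measurable_EFinP; apply: measurableT_comp => //; apply: measurableT_comp => //.
  apply: measurable_funM => //.
  have mB : measurable_fun setT (fun p : 'rV[R]_d * 'rV[R]_d => p.1 - p.2).
    apply: measurable_fun_rVP => i; under eq_fun do rewrite !mxE.
    by apply: measurable_funB; exact: measurable_rV_coord.
  exact: measurable_dotp.
have Eh j k : j != k -> (\int[P]_w (h (X j w, X k w))%:E <= B%:E)%E.
  move=> jk; rewrite (ge0_integral_iid_pair iidX jk mh)//.
  (* Writing [B] as its own integral against [pi] reduces the claim to a bound for each centre
     [y]. *)
  rewrite -[leRHS]mule1 -(@probability_setT _ _ _ pi) -integral_cst//.
  apply: ge0_le_integral => //.
  - by move=> y _; apply: integral_ge0 => x _; rewrite lee_fin.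
  - exact: (@measurable_fun_fubini_tonelli_G _ _ _ _ R pi (EFin \o h) mh).
  - move=> y _; rewrite -[leLHS]fineK; last first.
      apply: integrable_fin_num => //; exact: integrable_expR_sqdist (ltW l0).
    rewrite lee_fin; apply: laplace_sqdist_le LSI l0 _ => //.
    exact: trace_le_integral_sqdist.
have mhX j k : measurable_fun setT (fun w => (h (X j w, X k w))%:E).
  apply: (measurableT_comp mh); exact: measurable_fun_pair.
have Ek k : (\int[P]_w \int[std_gaussian d]_z error2 k w z <= (16 * n%:R * B)%:E)%E.
  apply: (@le_trans _ _ (\int[P]_w \sum_(j | j != k) (16%:E * (h (X j w, X k w))%:E))%E).
    apply: ge0_le_integral => //.
    - by move=> w _; apply: integral_ge0 => z _; rewrite lee_fin sqr_ge0.
    - exact: measurable_error2.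
    - by under eq_fun do rewrite -big_filter; apply: emeasurable_sum => j; exact: measurable_funeM.
    - move=> w _; under [leRHS]eq_bigr do rewrite -EFinM.
      by rewrite sumEFin; exact: integral_sqr_denoiser_error_le.
  under eq_integral do rewrite -big_filter.
  rewrite ge0_integral_sum//; last 2 first.
  - by move=> j; exact: measurable_funeM.
  - by move=> j w _; rewrite mule_ge0 ?lee_fin.
  rewrite big_filter.
  apply: (@le_trans _ _ (\sum_(j < n) (16 * B)%:E)%E).
    rewrite big_mkcond; apply: lee_sum => j _; case: ifPn => [jk|_].
      rewrite ge0_integralZl_EFin//; first by rewrite EFinM lee_pmul2l// Eh.
      by move=> w _; rewrite lee_fin.
    by rewrite lee_fin mulr_ge0// expR_ge0.
  by rewrite sumEFin sumr_const card_ord lee_fin -[leLHS]mulr_natr mulrAC.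
under eq_integral do rewrite sqr_errorE.
rewrite ge0_integralZl_EFin//; last 2 first.
- by move=> w _; apply: sume_ge0 => k _; apply: integral_ge0 => z _; rewrite lee_fin sqr_ge0.
- by apply: emeasurable_sum => k; exact: measurable_error2.
rewrite ge0_integral_sum//; last 2 first.
- by move=> k; exact: measurable_error2.
- by move=> k w _; apply: integral_ge0 => z _; rewrite lee_fin sqr_ge0.
apply: (@le_trans _ _ ((n%:R^-1)%:E * \sum_(k < n) (16 * n%:R * B)%:E)%E).
  by rewrite lee_wpmul2l ?lee_fin ?invr_ge0//; apply: lee_sum => k _; exact: Ek.
rewrite sumEFin sumr_const card_ord -EFinM lee_fin -[X in _ * X]mulr_natl mulrA.
rewrite ler_piMl ?mulr_ge0 ?expR_ge0//.
(* For [n = 0] the inverse is 0 by convention, so [n^-1 * n <= 1] still holds. *)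
by have [->|n0] := eqVneq n 0; rewrite ?mulr0// mulVf ?pnatr_eq0.
Qed.

End expected_error.

(** * Concentration *)

(** Translates a threshold for the norm into one for its square; for [x = +oo] both inequalities
    fail. *)
Lemma poweR_half_le (R : realType) (x : \bar R) (a : R) : (0 <= x)%E ->
  (x `^ 2^-1 <= (expR (- a))%:E)%E = (x <= (expR (- (2 * a)))%:E)%E.
Proof.
case: x => [x||]// x0; last by rewrite poweRyr ?invr_neq0// !leye_eq.
rewrite poweR_EFin !lee_fin powR12_sqrt//.
rewrite -mulrN expRM_natl -[LHS](ler_sqr); rewrite ?nnegrE ?sqrtr_ge0 ?expR_ge0//.
by rewrite sqr_sqrtr.
Qed.

(** Markov's inequality for [sqr_error] at the level [expR (- (2 * a))]. *)
Lemma prob_Lnorm_error_le (R : realType) (d n : nat) (dO : measure_display)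
    (Omega : measurableType dO) (t : R) (P : probability Omega R)
    (X : 'I_n -> {RV P >-> 'rV[R]_d}) (v : 'rV[R]_d) (a b : R) :
  (\int[P]_w sqr_error t X v w <= b%:E)%E ->
  (P (~` [set w | (Lnorm (empirical_noise (fun k => X k w)) 2%:E
      (fun p => (denoiser_coord t (fun k => X k w) v p - noise_coord v p)%:E)
    <= (expR (- a))%:E)%E]) <= (expR (2 * a) * b)%:E)%E.
Proof.
move=> Eb; have mI := measurable_sqr_error t X v.
pose e := expR (- (2 * a)).
rewrite (_ : ~` _ = setT `&` [set w | (e%:E < sqr_error t X v w)%E]); last first.
  rewrite setTI; apply/seteqP; split => w /=.
    move=> /negP; rewrite (Lnorm2E _ (fun p => denoiser_coord t _ v p - _)).
    by rewrite poweR_half_le ?sqr_error_ge0// -ltNge.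
  move=> ew; apply/negP; rewrite (Lnorm2E _ (fun p => denoiser_coord t _ v p - _)).
  by rewrite poweR_half_le ?sqr_error_ge0// -ltNge.
apply: (@le_trans _ _ (P (setT `&` [set w | (e%:E <= `|sqr_error t X v w|)%E]))).
  apply: le_measure; rewrite ?inE.
  - exact: emeasurable_fun_lt.
  - apply: emeasurable_fun_le => //; exact: measurableT_comp.
  - by move=> w [_ /= /ltW ew]; split => //=; rewrite gee0_abs ?sqr_error_ge0.
have e0 : 0 < e by exact: expR_gt0.
have := @le_integral_abse _ _ _ P setT measurableT _ _ mI e0.
under [X in (_ <= X)%E -> _]eq_integral do rewrite gee0_abs ?sqr_error_ge0//.
move=> /le_trans /(_ Eb); rewrite -lee_pdivlMl//.
by rewrite -expRN opprK -EFinM.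
Qed.

(** With [s] the square root of [d], the prefactor is at most [exp (32 m + s)]. The total exponent
    [3 s + 32 m - k s^2] is then at most [- s] once [k s^2 >= 32 m + 4 s]. *)
Lemma sqrt_exponent_eventually (R : realType) (k m : R) : 0 < k -> 0 < m ->
  \forall d \near \oo,
    expR (2 * (d%:R `^ 2^-1)) * (16 * (m * d%:R) * expR (- (k * d%:R))) <=
      expR (- (d%:R `^ 2^-1)) :> R.
Proof.
move=> k0 m0; near=> d.
rewrite powR12_sqrt//; set s := Num.sqrt _.
have s0 : 0 <= s by exact: sqrtr_ge0.
have ds : d%:R = s ^+ 2 :> R by rewrite sqr_sqrtr.
(* The quotient gives [32 m + 4 <= k s]; the extra 1 gives [1 <= s], so multiplying by [s] yields
   the required lower bound on [k s^2]. *)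
have hd : (32 * m + 4) / k + 1 <= s.
  rewrite -[leLHS]ger0_norm -?sqrtr_sqr ?ler_sqrt//; last first.
    by rewrite addr_ge0// divr_ge0 ?(ltW k0)// addr_ge0// mulr_ge0// ltW.
  by near: d; exact: nbhs_infty_ger.
have s1 : 1 <= s.
  by apply: le_trans hd; rewrite lerDr divr_ge0 ?(ltW k0)// addr_ge0// mulr_ge0// ltW.
have ks : 32 * m + 4 * s <= k * s ^+ 2.
  have ks' : 32 * m + 4 <= k * s.
    by rewrite -ler_pdivrMl// mulrC; apply: le_trans hd; rewrite lerDl.
  have := ler_wpM2r s0 ks'.
  have := ler_wpM2l (ltW m0) s1; lra.
have es : s ^+ 2 <= 2 * expR s.
  have := expR_ge1Dxn 1 s0; rewrite (_ : 2`! = 2%N)//; lra.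
have em : 32 * m <= expR (32 * m).
  by apply: le_trans (expR_ge1Dx _); rewrite lerDr.
rewrite ds.
apply: (@le_trans _ _ (expR (2 * s) * (expR (32 * m) * expR s * expR (- (k * s ^+ 2))))).
  rewrite ler_wpM2l ?expR_ge0// ler_wpM2r ?expR_ge0//.
  rewrite (_ : 16 * (m * s ^+ 2) = 16 * m * s ^+ 2); last by ring.
  apply: (@le_trans _ _ (16 * m * (2 * expR s))).
    by rewrite ler_wpM2l// mulr_ge0// ltW.
  rewrite (_ : 16 * m * (2 * expR s) = 32 * m * expR s); last by ring.
  by rewrite ler_wpM2r ?expR_ge0.
rewrite -!expRD ler_expR; lra.
Unshelve. all: by end_near. Qed.

Theorem proposition2 (R : realType) (t r c0 C_LSI : R)
  (n : nat -> nat)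
  (pi0 : forall d, probability 'rV[R]_d R)
  (Sigma : forall d, 'M[R]_d)
  (v : forall d, 'rV[R]_d)
  (disp : nat -> measure_display)
  (Omega : forall d, measurableType (disp d))
  (P : forall d, probability (Omega d) R)
  (X : forall d, 'I_(n d) -> {RV (P d) >-> 'rV[R]_d})
  (ht : 0 < t)
  (hr : 0 < r)
  (hn : n d @[d --> \oo] --> \oo)
  (hnr : ((n d)%:R / d%:R : R) @[d --> \oo] --> r)
  (hmc : forall d, has_mean_cov (pi0 d) 0 (Sigma d))
  (hc0 : 0 < c0)
  (hSigma : (c0%:E <= limn_einf (fun d => (\tr (Sigma d) / d%:R)%:E))%E)
  (hC : 1 <= C_LSI)
  (hLSI : forall d, log_sobolev (pi0 d) C_LSI)
  (hX : forall d, iid (pi0 d) (X d))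
  (hv : forall d, (0 < d)%N -> enorm (v d) = 1) :
  exists2 c : R, 0 < c &
    very_high_probability P (fun d =>
      [set w | (Lnorm (empirical_noise (fun k => X d k w)) 2%:E
                  (fun p => (denoiser_coord t (fun k => X d k w) (v d) p
                             - noise_coord (v d) p)%:E)
                <= (expR (- (d%:R `^ c)))%:E)%E]).
Proof.
have C0 : 0 < C_LSI by exact: lt_le_trans hC.
pose l := rho t ^+ 2 / (16 * sigma t ^+ 2).
have l0 : 0 < l.
  by rewrite divr_gt0 ?mulr_gt0 ?exprn_gt0 ?rho_gt0 ?sigma_gt0.
pose D := 1 + 2 * C_LSI * l.
have D0 : 0 < D by rewrite addr_gt0// mulr_gt0// mulr_gt0.
(* The decay rate per dimension, obtained from the eventual bound [c0 / 2 * d] on the trace. *)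
pose k := l * (c0 / 2) / D.
have k0 : 0 < k by rewrite divr_gt0// mulr_gt0// divr_gt0.
have trace_ge : \forall d \near \oo, c0 / 2 * d%:R <= \tr (Sigma d).
  (* Halving [c0] makes the inequality strict, so the tail infima eventually exceed [c0 / 2]. *)
  have c02 : ((c0 / 2)%:E < limn (einfs (fun d => (\tr (Sigma d) / d%:R)%:E)))%E.
    by rewrite -limn_einf_lim; apply: lt_le_trans hSigma; rewrite lte_fin; lra.
  have near_inf := lte_lim (@nondecreasing_einfs _ _) (@is_cvg_einfs _ _) c02.
  near=> d; have d0 : (0 < d)%N by near: d; exact: nbhs_infty_gt.
  rewrite -ler_pdivlMr ?ltr0n// -lee_fin.
  apply: (@le_trans _ _ (einfs (fun d => (\tr (Sigma d) / d%:R)%:E) d)).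
    by near: d; exact: near_inf.
  by apply: ereal_inf_lbound; exists d => /=.
have n_le : \forall d \near \oo, (n d)%:R <= 2 * r * d%:R :> R.
  have r2 : r < 2 * r by lra.
  near=> d; have d0 : (0 < d)%N by near: d; exact: nbhs_infty_gt.
  rewrite -ler_pdivrMr ?ltr0n//.
  by near: d; exact: (cvgr_le _ hnr).
(* Both exponents are one half: the Markov factor and the target probability cost only multiples of
   the square root of [d], against a decay linear in [d]. *)
exists 2^-1; first by rewrite invr_gt0.
exists 2^-1; first by rewrite invr_gt0.
near=> d.
have d0 : (0 < d)%N by near: d; exact: nbhs_infty_gt.
have := expected_sqr_error_le ht C0 (hLSI d) (hmc d) (hX d) (hv d d0).
move=> /(prob_Lnorm_error_le (d%:R `^ 2^-1)) /le_trans; apply.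
rewrite lee_fin.
apply: (@le_trans _ _ (expR (2 * (d%:R `^ 2^-1)) *
    (16 * (2 * r * d%:R) * expR (- (k * d%:R))))).
  rewrite ler_wpM2l ?expR_ge0//; apply: ler_pM => //.
    by rewrite ler_wpM2l//; near: d.
  rewrite ler_expR lerN2 /k -/l -/D mulrAC ler_wpM2r ?invr_ge0 ?(ltW D0)//.
  by rewrite -mulrA ler_wpM2l ?(ltW l0)//; near: d.
near: d; apply: sqrt_exponent_eventually => //.
by rewrite mulr_gt0.
Unshelve. all: by end_near. Qed.
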